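(* For $0\leq\alpha<1/2$, define \[ c_\alpha=\frac{2\alpha+\sqrt{4\alpha^2+3}}3,\qquad \Phi(\alpha)=2(c_\alpha-2\alpha)(1-c_\alpha^2). \] Let $k_n\geq2$ be integers such that \[ \frac{k_n}{\sqrt{n\log n}}\longrightarrow\alpha\quad(n\to\infty),\qquad 0\leq\alpha<\frac12. \] Then \[ \liminf_{n\to\infty}\frac{T(n,k_n)}{n^{3/2}\sqrt{\log n}}\geq\Phi(\alpha). \] In particular, $\Phi(0)=4/(3\sqrt3)$ and $\Phi(\alpha)\to0$ as $\alpha\uparrow1/2$.
   Context: $\log$ is the natural logarithm. For an integer $n\geq1$, $\mathcal{M}_n$ is the set (repeated values counted once) of all multinomial coefficient values $\frac{n!}{p_1!\cdots p_t!}$, where $(p_1,\ldots,p_t)$ ranges over all integer partitions of $n$ ($p_1\geq\cdots\geq p_t\geq1$, $p_1+\cdots+p_t=n$). For an integer $t$, $r_n(t)=\#\{(x,y):x,y\in\mathcal{M}_n,\ x\leq y,\ x+y=t\}$. For $k\geq2$, $T(n,k)=\#\{t:r_n(t)\geq k\}$. *)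

(* Defs.v *)
From HB Require Import structures.
From mathcomp Require Import all_boot all_order all_algebra finmap.
From mathcomp Require Import all_classical all_reals all_analysis.

Set Implicit Arguments.
Unset Strict Implicit.
Unset Printing Implicit Defensive.

Import Order.TTheory GRing.Theory Num.Theory.
Import numFieldNormedType.Exports.

Local Open Scope classical_set_scope.
Local Open Scope ring_scope.

Definition is_intpartition (n : nat) (p : seq nat) : bool :=
  [&& sorted geq p, all (leq 1) p & sumn p == n].

(* The natural-number division is exact. *)
Definition multinomial (n : nat) (p : seq nat) : nat :=
  (n`! %/ \prod_(i <- p) i`!)%N.

Definition multinomial_values (n : nat) : set nat :=
  [set multinomial n p | p in [set p | is_intpartition n p]].

Definition rep_pairs (n : nat) (t : int) : set (nat * nat) :=
  [set xy | [/\ multinomial_values n xy.1, multinomial_values n xy.2,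
                (xy.1 <= xy.2)%N & (xy.1 + xy.2)%:Z = t]].

(* [fset_set] is only meaningful on finite sets; see [finite_rep_pairs] and
   [finite_popular_sums] below. *)
Definition rep_count (n : nat) (t : int) : nat := #|` fset_set (rep_pairs n t)|.

Definition popular_sums (n k : nat) : set int :=
  [set t | (k <= rep_count n t)%N].

Definition popular_count (n k : nat) : nat := #|` fset_set (popular_sums n k)|.

Definition c_ {R : realType} (alpha : R) : R :=
  (2 * alpha + Num.sqrt (4 * alpha ^+ 2 + 3)) / 3.

Definition Phi {R : realType} (alpha : R) : R :=
  2 * (c_ alpha - 2 * alpha) * (1 - c_ alpha ^+ 2).

Lemma multinomial_values_le n : multinomial_values n `<=` `I_(n`!).+1.
Proof. by move=> _ [p _ <-] /=; rewrite ltnS leq_div. Qed.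

Lemma finite_multinomial_values n : finite_set (multinomial_values n).
Proof. exact: sub_finite_set (@multinomial_values_le n) (finite_II _). Qed.

Lemma finite_rep_pairs n t : finite_set (rep_pairs n t).
Proof.
apply: (@sub_finite_set _ _ (multinomial_values n `*` multinomial_values n)).
  by move=> xy [].
by apply: finite_setX; exact: finite_multinomial_values.
Qed.

Lemma finite_popular_sums n k : (0 < k)%N -> finite_set (popular_sums n k).
Proof.
move=> k0; pose V := multinomial_values n.
apply: (@sub_finite_set _ _ ((fun xy => (xy.1 + xy.2)%:Z) @` (V `*` V))).
  move=> t /= /(leq_trans k0); rewrite /rep_count cardfs_gt0 => /fset0Pn[xy].
  rewrite in_fset_set; last exact: finite_rep_pairs.
  by rewrite inE => -[Vx Vy _ <-]; exists xy.
by apply: finite_image; apply: finite_setX; exact: finite_multinomial_values.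
Qed.

(* Main.v *)
Require Import Defs.
From HB Require Import structures.
From mathcomp Require Import all_boot all_order all_algebra finmap.
From mathcomp Require Import all_classical all_reals all_analysis.
From mathcomp Require Import zify ring lra.

Import Order.TTheory GRing.Theory Num.Theory.
Import numFieldNormedType.Exports.

(** No prime number theorem is needed, because the quotient in the theorem in
    fact tends to infinity as soon as [k_n <= sqrt (n log n)] eventually.
    Let [W] be the product of the [(i!)^e] for [i <= y].  If [j <= 2^e] is
    [y]-smooth, then [W / j] is again a product of factorials: replace, for
    every prime factor [p] of [j], one factor [p!] by [(p - 1)!].  Hence, with
    [sc_b = n! / (W b!)], all the multiples [j * sc_b] with [j] smooth are
    multinomial coefficients, provided that [b] plus the total cost
    [O(e y^2)] of [W] is at most [n].  For [y = 2^(12q)] and [N = 2^q y], at most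
    [N / 12] of the integers up to [N] are not [y]-smooth, so each [s] in
    [(N/2, N]] is in at least [N / 12] ways a sum of two smooth numbers, and
    [s * sc_b] is popular.  For [b > N] the numbers [s * sc_b] are distinct, as
    [sc_b / sc_(b+1) = b + 1 > N].  With [2^(25q)] about [n], [N] exceeds
    [sqrt n] by a power of [n], and there are about [n N] popular sums. *)

(** * Multinomial values from incomplete partitions *)

Lemma size_le_card_fset_set (T : choiceType) (A : set T) (l : seq T) :
  finite_set A -> uniq l -> (forall x, x \in l -> A x) ->
  size l <= #|` fset_set A|.
Proof.
move=> Afin l_uniq lA; apply: uniq_leq_size => // x /lA Ax.
by rewrite in_fset_set // inE.
Qed.

Lemma dvdn_prod_fact (p : seq nat) : \prod_(i <- p) i`! %| (sumn p)`!.
Proof.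
elim: p => [|i p IHp]; first by rewrite big_nil dvd1n.
rewrite big_cons /= -(bin_fact (leq_addr (sumn p) i)) addKn.
by rewrite dvdn_mull // dvdn_pmul2l // fact_gt0.
Qed.

(** Padding [p] with parts equal to 1 gives a partition of [n] with the same product of
    factorials. *)
Lemma multinomial_values_of_parts (n v : nat) (p : seq nat) :
  all (leq 1) p -> sumn p <= n -> v * \prod_(i <- p) i`! = n`! ->
  multinomial_values n v.
Proof.
move=> p_gt0 p_le vE; pose p' := p ++ nseq (n - sumn p) 1.
have p'E : \prod_(i <- sort geq p') i`! = \prod_(i <- p) i`!.
  rewrite (perm_big p') /=; last by rewrite perm_sort.
  by rewrite big_cat big_nseq /= (_ : 1`! = 1) // iter_muln exp1n !muln1.
exists (sort geq p') => /=; last first.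
  by rewrite /multinomial p'E -vE mulnK // prodn_gt0 // => i; exact: fact_gt0.
rewrite /is_intpartition sort_sorted; last by move=> a b /=; exact: leq_total.
rewrite all_sort all_cat p_gt0 all_nseq orbT /=.
by rewrite (perm_sumn (permEl (perm_sort _ _))) sumn_cat sumn_nseq mul1n subnKC.
Qed.

(** * Smooth numbers and the product of factorials they divide *)

Definition rough (y : nat) : nat_pred := [pred p | y < p].

Definition smooth (y j : nat) : bool := j`_(rough y) == 1.

(** This is the prime factorisation of [j]. The index may run over all integers, to match [tower],
    since [logn i j] is 0 for [i] not prime. *)
Lemma smooth_prod (y j : nat) :
  0 < j -> smooth y j -> \prod_(1 <= i < y.+1) i ^ logn i j = j.
Proof.
move=> j_gt0 /eqP sj.
have {2}-> : j = j`_(rough y)^' by rewrite -[LHS](partnC (rough y) j_gt0) sj mul1n.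
(* The index 0 contributes [0 ^ 0 = 1], so the range may start at 1. *)
rewrite (widen_partn _ (leq_maxr y j)) [RHS]big_ltn_cond //= mul1n.
rewrite (@big_nat_widen _ _ _ 1 y.+1 (maxn y j).+1) ?ltnS ?leq_maxl //=.
by apply: eq_bigl => i; rewrite !inE /= ltnS leqNgt.
Qed.

(** This is the [W] of the overview. *)
Definition tower (y e : nat) : nat := \prod_(1 <= i < y.+1) i`! ^ e.

(** The parts whose factorials multiply to [W / j]. *)
Definition tower_parts (y e j : nat) : seq nat :=
  flatten [seq nseq (e - logn i j) i ++ nseq (logn i j) i.-1
          | i <- index_iota 1 y.+1].

Lemma tower_parts_gt0 (y e j : nat) : all (leq 1) (tower_parts y e j).
Proof.
apply/allP => x /flatten_mapP[i].
rewrite mem_index_iota mem_cat !mem_nseq => /andP[i_gt0 _].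
case/orP => /andP[+ /eqP ->] //.
(* A part [i.-1] could vanish only for [i = 1], which occurs [logn 1 j = 0] times. *)
by case: i i_gt0 => [|[|i]] // _; rewrite lognE.
Qed.

Lemma logn_le_exp (e i j : nat) : j <= 2 ^ e -> logn i j <= e.
Proof.
move=> je; case: (posnP j) => [->|j_gt0]; first by rewrite logn0.
case: (boolP (prime i)) => [i_prime|i_prime]; last first.
  by rewrite lognE (negbTE i_prime).
rewrite -(leq_exp2l (logn i j) e (isT : 1 < 2)); apply: leq_trans je.
apply: leq_trans (dvdn_leq j_gt0 (pfactor_dvdnn i j)).
by case: (logn i j) => // l; rewrite leq_exp2r // prime_gt1.
Qed.

Lemma sumn_tower_parts (y e j : nat) :
  j <= 2 ^ e -> sumn (tower_parts y e j) <= e * y ^ 2.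
Proof.
move=> je; rewrite /tower_parts sumn_flatten sumnE big_map big_map big_seq.
apply: (@leq_trans (\sum_(i <- index_iota 1 y.+1) e * y)).
  rewrite [leqRHS]big_seq; apply: leq_sum => i; rewrite mem_index_iota => /andP[i0 iy].
  rewrite sumn_cat !sumn_nseq; have := logn_le_exp e i j je.
  by nia.
by rewrite big_const_seq count_predT size_iota iter_addn_0; nia.
Qed.

(** Lowering one [i!] to [(i - 1)!] releases a factor [i]; by [smooth_prod] the released factors
    multiply to [j]. *)
Lemma prod_tower_parts (y e j : nat) :
  0 < j <= 2 ^ e -> smooth y j ->
  j * \prod_(i <- tower_parts y e j) i`! = tower y e.
Proof.
move=> /andP[j_gt0 je] sj.
rewrite -{1}(smooth_prod y j j_gt0 sj) /tower_parts big_flatten big_map /tower.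
rewrite -big_split /=; apply: eq_big_nat => i /andP[i_gt0 _].
rewrite big_cat !big_nseq /= !iter_muln_1.
rewrite mulnC -mulnA -expnMn [_.-1`! * i]mulnC.
rewrite -{3}(prednK i_gt0) -[_ * (i.-1)`!]factS (prednK i_gt0).
by rewrite -expnD subnK // logn_le_exp.
Qed.

Definition scale (n y e b : nat) : nat := n`! %/ (tower y e * b`!).

(** The division in [scale] is exact: [b] and the parts for [j = 1] have sum at most [n]. *)
Lemma scaleP (n y e b : nat) :
  0 < b -> e * y ^ 2 + b <= n -> scale n y e b * (tower y e * b`!) = n`!.
Proof.
move=> b_gt0 bn; have s1 : smooth y 1 by rewrite /smooth partn1.
have e1 : 0 < 1 <= 2 ^ e by rewrite expn_gt0.
rewrite /scale divnK // -(prod_tower_parts y e 1 e1 s1) mul1n mulnC.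
have := dvdn_prod_fact (b :: tower_parts y e 1); rewrite big_cons => /dvdn_trans; apply.
rewrite (@fact_split n (sumn (b :: tower_parts y e 1))) ?dvdn_mulr //=.
by have := sumn_tower_parts y e 1 (proj2 (andP e1)); lia.
Qed.

Lemma multinomial_values_scale (n y e b j : nat) :
  0 < b -> e * y ^ 2 + b <= n -> 0 < j <= 2 ^ e -> smooth y j ->
  multinomial_values n (j * scale n y e b).
Proof.
move=> b_gt0 bn je sj.
apply: (@multinomial_values_of_parts n _ (b :: tower_parts y e j)).
- by rewrite /= b_gt0 tower_parts_gt0.
- by have := sumn_tower_parts y e j (proj2 (andP je)) => /=; lia.
- rewrite big_cons -(scaleP n y e b b_gt0 bn) -(prod_tower_parts y e j je sj).
  by rewrite [j * scale _ _ _ _]mulnC [b`! * _]mulnC !mulnA.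
Qed.

(** * Counting the integers that are not smooth *)

Lemma fact_addn_le (m k : nat) : (m + k)`! <= m`! * (m + k) ^ k.
Proof.
elim: k => [|k IHk]; first by rewrite addn0 muln1.
rewrite addnS factS expnS mulnCA leq_mul2l /=.
apply: (leq_trans IHk); rewrite leq_mul2l.
by case: k {IHk} => [|k]; rewrite ?expn0 ?orbT // leq_exp2r // leqnSn orbT.
Qed.

(** Passing from [y] to [y.+1] adds [K] factors on the left, each at most [K * y.+1]. *)
Lemma fact_muln_le (K y : nat) : (K * y)`! <= K ^ (K * y) * y`! ^ K.
Proof.
elim: y => [|y IHy]; first by rewrite muln0 exp1n.
rewrite mulnS [K + _]addnC; apply: (leq_trans (fact_addn_le _ _)).
rewrite factS expnD.
have -> : K * y + K = K * y.+1 by rewrite mulnS addnC.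
rewrite !expnMn; have := leq_mul IHy (leqnn (K ^ K * y.+1 ^ K)); lia.
Qed.

(** Rough parts are multiplicative, and that of a non-smooth number has a prime factor above [y]. *)
Lemma rough_part_fact_ge (y N : nat) :
  y.+1 ^ count (predC (smooth y)) (iota 1 N) <= N`!`_(rough y).
Proof.
elim: N => [|N IHN]; first by rewrite partn1.
rewrite -{1}[N.+1]addn1 iotaD count_cat expnD factS [N.+1 * _]mulnC partnM ?fact_gt0 //.
rewrite leq_mul // add1n /= addn0 /smooth; case: eqVneq => [->|] //= rN.
have pr : 1 < N.+1`_(rough y) by rewrite ltn_neqAle eq_sym rN part_gt0.
rewrite expn1; apply: leq_trans (pdiv_leq (part_gt0 _ _)).
have /pnatP := part_pnat (rough y) N.+1; apply; rewrite ?part_gt0 ?pdiv_prime //.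
exact: pdiv_dvd.
Qed.

Lemma rough_part_fact (y : nat) : y`!`_(rough y) = 1.
Proof.
apply: part_p'nat; apply/pnatP; first exact: fact_gt0.
move=> p p_prime; rewrite !inE -leqNgt fact_prod Euclid_dvd_prod // big_has => /hasP[i].
rewrite mem_index_iota => /andP[i_gt0 iy] /(dvdn_leq i_gt0) pi.
exact: leq_trans pi iy.
Qed.

(* [(K * y)`! %/ y`! ^ K] is at most [K ^ (K * y)], yet contains all the rough
   parts of [1, ..., K * y], as [y`!] has no prime factor above [y]. *)
Lemma count_rough (K y : nat) :
  y.+1 ^ count (predC (smooth y)) (iota 1 (K * y)) <= K ^ (K * y).
Proof.
apply: (leq_trans (rough_part_fact_ge y (K * y))).
have dv : y`! ^ K %| (K * y)`!.
  have := dvdn_prod_fact (nseq K y).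
  by rewrite big_nseq iter_muln_1 sumn_nseq mulnC.
rewrite -{1}(divnK dv) partnM ?divn_gt0 ?expn_gt0 ?fact_gt0 //; last first.
  by rewrite dvdn_leq ?fact_gt0.
rewrite partnX rough_part_fact exp1n muln1.
apply: (leq_trans (dvdn_leq _ (dvdn_part _ _))).
  by rewrite divn_gt0 ?expn_gt0 ?fact_gt0 // dvdn_leq ?fact_gt0.
rewrite leq_divLR //; exact: fact_muln_le.
Qed.

(** * Constructing and separating popular sums *)

Lemma scale_gt0 (n y e b : nat) :
  0 < b -> e * y ^ 2 + b <= n -> 0 < scale n y e b.
Proof.
move=> b_gt0 bn; have := fact_gt0 n.
by rewrite -(scaleP n y e b b_gt0 bn) muln_gt0 => /andP[].
Qed.

(** Since [b! >= b * b'!], the two scales differ by a factor of at least [b > N]. Hence multiples by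
    factors in [[1, N]] cannot agree for different [b]. *)
Lemma scale_lt (n y e b b' N : nat) :
  0 < b' < b -> N < b -> e * y ^ 2 + b <= n ->
  N * scale n y e b < scale n y e b'.
Proof.
move=> /andP[b'_gt0 b'b] Nb bn; have b_gt0 : 0 < b by apply: leq_trans b'b.
have b'n : e * y ^ 2 + b' <= n by lia.
have := scaleP n y e b b_gt0 bn; rewrite -(scaleP n y e b' b'_gt0 b'n).
have b'f : b * b'`! <= b`!.
  rewrite -(prednK b_gt0) factS prednK // leq_mul2l.
  by rewrite leq_fact ?orbT //; lia.
have T_gt0 : 0 < tower y e.
  by rewrite prodn_gt0 // => i; rewrite expn_gt0 fact_gt0.
rewrite !mulnA ![_ * tower y e]mulnC -!mulnA => /eqP; rewrite eqn_pmul2l // => /eqP E.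
have sb_gt0 := scale_gt0 n y e b b_gt0 bn.
rewrite -(ltn_pmul2r (fact_gt0 b')) -E.
apply: leq_trans (leq_mul (leqnn _) b'f).
by rewrite mulnA ltn_pmul2r ?fact_gt0 // mulnC ltn_pmul2l.
Qed.

(** Each split [s = j + (s - j)] with [1 <= j <= s / 2] gives a pair unless [j] or [s - j] is not
    smooth, and each of these two failures occurs at most as often as there are non-smooth numbers
    up to [N]. *)
Lemma rep_count_scale (n y e b s N : nat) :
  0 < b -> e * y ^ 2 + b <= n -> s <= N <= 2 ^ e ->
  s./2 <= rep_count n (s * scale n y e b)%:Z
            + 2 * count (predC (smooth y)) (iota 1 N).
Proof.
move=> b_gt0 bn /andP[sN Ne].
set sc := scale n y e b; have sc_gt0 : 0 < sc by exact: scale_gt0.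
pose good := predI (smooth y) (fun j => smooth y (s - j)).
pose l := [seq (j * sc, (s - j) * sc) | j <- iota 1 s./2 & good j].
have l_uniq : uniq l.
  rewrite map_inj_uniq ?filter_uniq ?iota_uniq // => i j [/eqP].
  by rewrite eqn_pmul2r // => /eqP.
have l_rep x : x \in l -> rep_pairs n (s * sc)%:Z x.
  move=> /mapP[j]; rewrite mem_filter mem_iota => /andP[/andP[/= sj ssj] js] ->.
  split => /=; [| |by nia|by congr Posz; nia].
  - by apply: multinomial_values_scale => //; lia.
  - by apply: multinomial_values_scale => //; lia.
have := size_le_card_fset_set _ _ _ (finite_rep_pairs n (s * sc)%:Z) l_uniq l_rep.
rewrite size_map size_filter -/(rep_count _ _) => r_ge.
set bad := count (predC (smooth y)) (iota 1 N).
have bad1 : count (predC (smooth y)) (iota 1 s./2) <= bad.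
  rewrite /bad -!size_filter uniq_leq_size ?filter_uniq ?iota_uniq // => j.
  by rewrite !mem_filter !mem_iota => /andP[-> /=]; lia.
pose rough_compl : pred nat := fun j => ~~ smooth y (s - j).
have bad2 : count rough_compl (iota 1 s./2) <= bad.
  rewrite -[leqLHS](count_map (subn s) (predC (smooth y))) /bad -!size_filter.
  rewrite uniq_leq_size ?filter_uniq ?map_inj_in_uniq ?iota_uniq //.
    by move=> i j; rewrite !mem_iota; lia.
  move=> j; rewrite !mem_filter mem_iota => /andP[-> /= /mapP[i]].
  by rewrite mem_iota => + ->; lia.
rewrite -[leqLHS](size_iota 1) -(count_predC good) mul2n -addnn leq_add //.
apply: leq_trans (leq_add bad1 bad2).
rewrite -count_predUI; apply: leq_trans (leq_addr _ _).
by apply: sub_count => j /=; rewrite negb_and.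
Qed.

(** Here [N = 4 * M]. For [s > 2 * M] there are at least [M] splits, of which at most [2 * M / 3]
    are lost; the remaining [M / 3] suffice for [k]. *)
Lemma popular_count_ge (n y e M B k : nat) :
  0 < k -> 3 * k <= M -> 4 * M <= 2 ^ e -> e * y ^ 2 + 4 * M + B <= n ->
  3 * count (predC (smooth y)) (iota 1 (4 * M)) <= M ->
  2 * M * B <= popular_count n k.
Proof.
move=> k_gt0 kM Me Bn bad.
pose S := iota (2 * M).+1 (2 * M); pose Bs := iota (4 * M).+1 B.
pose f s b := Posz (s * scale n y e b).
have l_uniq : uniq [seq f s b | s <- S, b <- Bs].
  apply: allpairs_uniq; rewrite ?iota_uniq // => -[s b] [s' b'].
  rewrite /S /Bs => /allpairsP[[s1 b1] /=]; rewrite !mem_iota => -[s1P b1P [-> ->]].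
  move=> /allpairsP[[s2 b2] /=]; rewrite !mem_iota => -[s2P b2P [-> ->]].
  rewrite /f => -[].
  case: (ltngtP b1 b2) => [b12|b21|<-].
  - have := @scale_lt n y e b2 b1 (4 * M); nia.
  - have := @scale_lt n y e b1 b2 (4 * M); nia.
  - move/eqP; rewrite eqn_pmul2r; first by move/eqP->.
    by apply: scale_gt0; lia.
have l_pop t : t \in [seq f s b | s <- S, b <- Bs] -> popular_sums n k t.
  move=> /allpairsP[[s b] /=]; rewrite !mem_iota => -[sP bP ->]; rewrite /popular_sums /=.
  have := @rep_count_scale n y e b s (4 * M); rewrite /f; lia.
have := size_le_card_fset_set _ _ _ (finite_popular_sums n k_gt0) l_uniq l_pop.
by rewrite size_allpairs !size_iota.
Qed.

Lemma popular_count_pow (n q k : nat) :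
  0 < k -> 0 < q -> 26 * q <= 2 ^ q -> 2 ^ (25 * q) <= n ->
  12 * k <= 2 ^ (13 * q) -> 2 ^ (13 * q) * n <= 16 * popular_count n k.
Proof.
move=> k_gt0 q_gt0 q_le qn kq.
pose M := 2 ^ (13 * q - 2).
have ME : 2 ^ (13 * q) = 4 * M by rewrite -(expnD 2 2); congr (2 ^ _); lia.
have M12 : 2 ^ (13 * q) = 2 ^ q * 2 ^ (12 * q) by rewrite -expnD; congr (2 ^ _); lia.
have y2 : (2 ^ (12 * q)) ^ 2 * 2 ^ q = 2 ^ (25 * q).
  by rewrite -expnM -expnD; congr (2 ^ _); lia.
(* With [K = 2 ^ q] and [y = K ^ 12], comparing exponents of 2 in [count_rough] gives
   [12 * q * c <= q * (4 * M)]. *)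
have bad : 12 * count (predC (smooth (2 ^ (12 * q)))) (iota 1 (4 * M)) <= 4 * M.
  have := count_rough (2 ^ q) (2 ^ (12 * q)).
  rewrite -M12 ME; set c := count _ _ => h.
  have : 2 ^ (12 * q * c) <= 2 ^ (q * (4 * M)).
    rewrite (expnM _ (12 * q) c) (expnM _ q (4 * M)); apply: leq_trans h.
    by case: (c) => // c'; rewrite leq_exp2r.
  by rewrite leq_exp2l //; nia.
have Mn : 2 ^ 4 * M <= n.
  by apply: leq_trans qn; rewrite -expnD leq_exp2l //; lia.
(* [B] is the room left for [b]: the tower costs at most [n / 2] because [26 * q <= 2 ^ q], and
   [4 * M <= n / 4], so [B >= n / 4]. *)
have := @popular_count_ge n (2 ^ (12 * q)) (13 * q) M
  (n - 13 * q * (2 ^ (12 * q)) ^ 2 - 4 * M) k.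
rewrite ME; set z := (2 ^ (12 * q)) ^ 2 in y2 *.
have zn : 26 * q * z <= n by apply: leq_trans qn; rewrite -y2; nia.
by nia.
Qed.

(** * Asymptotic estimates *)

Local Open Scope classical_set_scope.
Local Open Scope ring_scope.

Lemma le_limn_einf (R : realType) (c : \bar R) (u : nat -> \bar R) :
  (\forall n \near \oo, (c <= u n)%E) -> (c <= limn_einf u)%E.
Proof.
move=> [m _ cu]; rewrite limn_einf_lim; apply: lime_ge; first exact: is_cvg_einfs.
exists m => // p /= mp; apply: le_ereal_inf_tmp => _ [r /= pr <-].
by apply: cu => /=; exact: leq_trans mp pr.
Qed.

Lemma exp2_quadratic (q : nat) :
  (8 <= q)%N -> (q.+1 ^ 2 <= 2 ^ q)%N /\ (26 * q <= 2 ^ q)%N.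
Proof.
elim: q => // q IHq; rewrite leq_eqVlt => /predU1P[[<-]//|/[dup] /IHq[]].
by rewrite (expnS 2 q) => q2 q26 q8; split; nia.
Qed.

(** Let [q] be the integer part of [log2 n / 25]. Then [n < 2 ^ (25 * q.+1)] and
    [ln n <= 25 * q.+1], so [C^2 * n * ln n <= 2 ^ (25 * q) * D * q.+1]. For large [q] this is at
    most [2 ^ (26 * q)], as [D <= q.+1] and [q.+1 ^ 2 <= 2 ^ q]. *)
Lemma pow_dominates (R : realType) (C : R) :
  \forall n \near \oo, exists q,
    [/\ (0 < q)%N, (26 * q <= 2 ^ q)%N, (2 ^ (25 * q) <= n)%N
      & C * Num.sqrt (n%:R * ln n%:R) <= (2 ^ (13 * q))%:R].
Proof.
pose D := C ^+ 2 * 2 ^+ 25 * 25%:R; pose Q := maxn 8 (Num.truncn D).+1.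
exists (2 ^ (25 * Q))%N => // n /= Qn.
have n_gt0 : (0 < n)%N by apply: leq_trans Qn; rewrite expn_gt0.
have /andP[n_ge n_lt] := trunc_log_bounds (isT : 1 < 2)%N n_gt0.
set L := trunc_log 2 n in n_ge n_lt; pose q := (L %/ 25)%N.
have Qq : (Q <= q)%N.
  by rewrite leq_divRL // mulnC trunc_log_max.
have q_ge8 : (8 <= q)%N by apply: leq_trans Qq; exact: leq_maxl.
have [q2 q26] := exp2_quadratic q q_ge8.
exists q; split => //; first by lia.
  by apply: leq_trans n_ge; rewrite leq_exp2l // mulnC leq_trunc_div.
have n_lt' : n%:R <= 2 ^+ (25 * q.+1) :> R.
  rewrite -natrX ler_nat; apply: (leq_trans (ltnW n_lt)); rewrite leq_exp2l //.
  by rewrite mulnC ltn_ceil.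
have ln_le : ln n%:R <= (25 * q.+1)%:R :> R.
  apply: (@le_trans _ _ (ln (2 ^+ (25 * q.+1)))).
    by rewrite ler_ln // posrE ?ltr0n ?exprn_gt0.
  rewrite lnXn // -[X in _ <= X]mulr1 mulr_natl lerMn2r.
  by have := @le_ln1Dx R 1; rewrite -natr1 => -> //; rewrite orbT.
have DQ : D <= q.+1%:R.
  rewrite (le_trans (ltW (truncnS_gt D))) // ler_nat.
  by rewrite ltnS ltnW // (leq_trans _ Qq) // leq_maxr.
have ln_ge0' : 0 <= ln n%:R :> R by rewrite ln_ge0 // ler1n.
apply: (@le_trans _ _ (`|C| * Num.sqrt (n%:R * ln n%:R))).
  by rewrite ler_wpM2r ?sqrtr_ge0 // ler_norm.
rewrite -(@ler_pXn2r _ 2) ?nnegrE ?mulr_ge0 ?sqrtr_ge0 ?ler0n //.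
rewrite exprMn sqr_sqrtr ?mulr_ge0 ?ler0n // real_normK ?num_real //.
apply: (@le_trans _ _ (C ^+ 2 * (2 ^+ (25 * q.+1) * (25 * q.+1)%:R))).
  by rewrite ler_wpM2l ?sqr_ge0 // ler_pM.
rewrite natrM mulnS exprD.
have -> : C ^+ 2 * (2 ^+ 25 * 2 ^+ (25 * q) * (25%:R * q.+1%:R))
        = 2 ^+ (25 * q) * (D * q.+1%:R) by rewrite /D; ring.
have -> : (2 ^ (13 * q))%:R ^+ 2 = 2 ^+ (25 * q) * (2 ^ q)%:R :> R.
  by rewrite !natrX -exprM -exprD; congr (_ ^+ _); lia.
rewrite ler_wpM2l ?exprn_ge0 //; apply: le_trans (_ : q.+1%:R * q.+1%:R <= _).
  by rewrite ler_wpM2r.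
by rewrite -natrM ler_nat.
Qed.

(** As [c] is arbitrary, the quotient tends to infinity. *)
Lemma popular_density_ge (R : realType) (c : R) (k : nat -> nat) :
  (forall n, (0 < n)%N -> (0 < k n)%N) ->
  (\forall n \near \oo, (k n)%:R <= Num.sqrt (n%:R * ln n%:R) :> R) ->
  \forall n \near \oo,
    c <= (popular_count n (k n))%:R / (n%:R `^ (3 / 2) * Num.sqrt (ln n%:R)).
Proof.
move=> k_gt0 k_le; near=> n.
have n_gt1 : (1 < n)%N by near: n; exists 2%N.
have n_gt0 : (0 < n)%N by exact: ltnW.
(* The summand 12 provides [12 * k n <= 2 ^ (13 * q)]; the summand [16 * |c|] absorbs the factor 16
   of [popular_count_pow]. *)
have [q [q_gt0 q26 qn qC]] : exists q,
    [/\ (0 < q)%N, (26 * q <= 2 ^ q)%N, (2 ^ (25 * q) <= n)%N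
      & (12 + 16 * `|c|) * Num.sqrt (n%:R * ln n%:R) <= (2 ^ (13 * q))%:R :> R].
  by near: n; exact: pow_dominates.
have kX : (k n)%:R <= Num.sqrt (n%:R * ln n%:R) :> R by near: n.
set X := Num.sqrt _ in qC kX.
have X_ge0 : 0 <= X by exact: sqrtr_ge0.
have cX : 0 <= `|c| * X by rewrite mulr_ge0.
have k12 : (12 * k n <= 2 ^ (13 * q))%N.
  rewrite -(ler_nat R) natrM; nra.
have pc := popular_count_pow n q (k n) (k_gt0 n n_gt0) q_gt0 q26 qn k12.
have ln_gt0' : 0 < ln n%:R :> R by rewrite ln_gt0 // ltr1n.
have -> : n%:R `^ (3 / 2) * Num.sqrt (ln n%:R) = n%:R * X :> R.
  have -> : 3 / 2 = 1 + 2^-1 :> R by field.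
  rewrite powRD ?pnatr_eq0 -?lt0n ?n_gt0 ?implybT //.
  by rewrite powRr1 ?ler0n // powR12_sqrt ?ler0n // -mulrA -sqrtrM ?ler0n.
have nX : 0 < n%:R * X by rewrite mulr_gt0 ?ltr0n ?sqrtr_gt0 // mulr_gt0 ?ltr0n.
rewrite ler_pdivlMr //.
apply: (@le_trans _ _ ((2 ^ (13 * q))%:R * n%:R / 16)); last first.
  by rewrite ler_pdivrMr // -!natrM ler_nat [(popular_count _ _ * _)%N]mulnC.
rewrite mulrCA [_%:R * n%:R]mulrC -mulrA ler_wpM2l ?ler0n //.
have := ler_wpM2r X_ge0 (ler_norm c); lra.
Unshelve. all: by end_near.
Qed.

(** * Special values and continuity of [Phi], and the conclusion *)

Lemma Phi0 (R : realType) : Phi (0 : R) = 4 / (3 * Num.sqrt 3).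
Proof.
rewrite /Phi /c_ expr0n /= !mulr0 !add0r subr0.
have s3 : Num.sqrt 3 ^+ 2 = 3 :> R by rewrite sqr_sqrtr.
have s_gt0 : 0 < Num.sqrt 3 :> R by rewrite sqrtr_gt0.
have -> : 4 / (3 * Num.sqrt 3) = 4 * Num.sqrt 3 / (3 * Num.sqrt 3 ^+ 2) :> R.
  by field; rewrite lt0r_neq0.
by rewrite expr_div_n s3; field.
Qed.

Lemma Phi_half (R : realType) : Phi (1 / 2 : R) = 0.
Proof.
have c1 : c_ (1 / 2) = 1 :> R.
  have s4 : 4 * (1 / 2) ^+ 2 + 3 = 2 ^+ 2 :> R by field.
  by rewrite /c_ s4 sqrtr_sqr ger0_norm //; field.
by rewrite /Phi c1; ring.
Qed.

Lemma continuous_Phi (R : realType) : continuous (@Phi R).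
Proof.
have c_cont : continuous (@c_ R).
  move=> a; apply: cvgMr_tmp; apply: cvgD; first by apply: cvgMl_tmp; exact: cvg_id.
  apply: continuous_comp; last exact: sqrt_continuous.
  by apply: cvgD; [apply: cvgMl_tmp; exact: exprn_continuous|exact: cvg_cst].
move=> a; apply: cvgM.
  by apply: cvgMl_tmp; apply: cvgB; [exact: c_cont|apply: cvgMl_tmp; exact: cvg_id].
apply: cvgB; first exact: cvg_cst.
exact: (continuous_comp (c_cont a) (@exprn_continuous R 2 (c_ a))).
Qed.

Theorem theorem1p5 (R : realType) :
  [/\ forall (alpha : R) (k : nat -> nat),
        0 <= alpha < 1 / 2 ->
        (forall n : nat, (1 <= n)%N -> (2 <= k n)%N) ->
        (fun n : nat => (k n)%:R / Num.sqrt (n%:R * ln (n%:R : R)) : R) @ \oo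
          --> alpha ->
        ((Phi alpha)%:E <=
          limn_einf (fun n : nat =>
            ((popular_count n (k n))%:R /
              ((n%:R : R) `^ (3 / 2) * Num.sqrt (ln (n%:R : R))))%:E))%E,
      Phi (0 : R) = 4 / (3 * Num.sqrt 3)
    & Phi alpha @[alpha --> (1 / 2 : R)^'-] --> (0 : R)].
Proof.
split; [|exact: Phi0|]; last first.
  (* By continuity the left limit at [1 / 2] is the value there. *)
  by rewrite -(Phi_half R); apply: cvg_at_left_filter; exact: continuous_Phi.
move=> alpha k /andP[_ alpha_lt] k_ge2 k_cvg; apply: le_limn_einf.
under eq_near do rewrite lee_fin.
apply: popular_density_ge => [n n_gt0|]; first exact: ltnW (k_ge2 n n_gt0).
(* The limit [alpha] is below 1, so [k n] is eventually below [sqrt (n log n)]. *)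
have lt1 : \forall n \near \oo, (k n)%:R / Num.sqrt (n%:R * ln (n%:R : R)) < 1 :> R.
  by apply: (cvgr_lt _ k_cvg); lra.
near=> n; have n_gt1 : (1 < n)%N by near: n; exists 2%N.
have X_gt0 : 0 < Num.sqrt (n%:R * ln (n%:R : R)).
  by rewrite sqrtr_gt0 mulr_gt0 ?ln_gt0 ?ltr1n ?ltr0n // ltnW.
rewrite -[leRHS]mul1r -ler_pdivrMr //; apply: ltW; near: n; exact: lt1.
Unshelve. all: by end_near.
Qed.
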